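(* Let $\rho>0$ and $\tilde\rho=1/(1+\rho)$. Let $\{(X_i,Y_i)\}_{i\in\mathbb N}$ be a discrete-time stochastic process with finite alphabet $\mathcal X\times\mathcal Y$, and suppose that the conditional Rényi entropy-rate $H_{\tilde\rho}(\boldsymbol X|\boldsymbol Y)=\lim_{n\to\infty}H_{\tilde\rho}(X^n|Y^n)/n$ exists. Let $R_1,R_2>0$. Then the privacy-exponent $\overline{E_{\mathrm E}}$ for the rate-pair $(R_1,R_2)$ (defined in the context) is $$\overline{E_{\mathrm E}}=\begin{cases}\rho\,\min\{R_1,\,R_2,\,H_{\tilde\rho}(\boldsymbol X|\boldsymbol Y)\}, & \text{if } R_1+R_2>H_{\tilde\rho}(\boldsymbol X|\boldsymbol Y),\\ -\infty, & \text{if } R_1+R_2<H_{\tilde\rho}(\boldsymbol X|\boldsymbol Y).\end{cases}$$ This holds both when Bob's ambiguity $\mathscr A_{\mathrm B}$ in the definition of the privacy-exponent is the guessing ambiguity $\mathscr A_{\mathrm B}^{(\mathrm g)}$ and when it is the list ambiguity $\mathscr A_{\mathrm B}^{(\mathrm l)}$.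
   Context: Logarithms $\log$ are to base 2. $X^n=(X_1,\dots,X_n)$, $Y^n=(Y_1,\dots,Y_n)$, and $P_{X^n,Y^n}$ is the PMF of $(X^n,Y^n)$. Conditional Rényi entropy (Arimoto) of order $\alpha\in(0,1)$, for $(X,Y)\sim P_{X,Y}$ on a finite set $\mathcal X\times\mathcal Y$: $H_\alpha(X|Y)=\frac{\alpha}{1-\alpha}\log\sum_{y}\left(\sum_{x}P_{X,Y}(x,y)^\alpha\right)^{1/\alpha}$. One-shot definitions. Let $(X,Y)\sim P_{X,Y}$ on a finite set $\mathcal X\times\mathcal Y$ and let $\mathcal M_1,\mathcal M_2$ be finite sets. A (stochastic) encoder is a conditional PMF $\mathbb P[M_1=m_1,M_2=m_2\mid X=x,Y=y]$ on $\mathcal M_1\times\mathcal M_2$ for each $(x,y)$. For side information $W$ in a finite set $\mathcal W$, a guessing function $G(\cdot|W)$ for $X$ is a choice, for each $w\in\mathcal W$, of a bijection $G(\cdot|w):\mathcal X\to\{1,\dots,|\mathcal X|\}$. Define - $\mathscr A_{\mathrm B}^{(\mathrm g)}(P_{X,Y})=\min_G\mathbb E[G(X|Y,M_1,M_2)^\rho]$ (minimum over guessing functions with side information $(Y,M_1,M_2)$); - $\mathscr A_{\mathrm B}^{(\mathrm l)}(P_{X,Y})=\mathbb E[|\mathcal L^Y_{M_1,M_2}|^\rho]$, where $\mathcal L^y_{m_1,m_2}=\{x:\mathbb P[X=x|Y=y,M_1=m_1,M_2=m_2]>0\}$; - $\mathscr A_{\mathrm E}(P_{X,Y})=\min_{G_1,G_2}\mathbb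 E[\min\{G_1(X|Y,M_1)^\rho,G_2(X|Y,M_2)^\rho\}]$ (minimum over guessing functions $G_1$ with side information $(Y,M_1)$ and $G_2$ with side information $(Y,M_2)$). Asymptotic definitions. For each $n$, let $\mathcal M_k=\{1,\dots,2^{nR_k}\}$ for $k=1,2$, meaning the set of positive integers not exceeding $2^{nR_k}$; a stochastic encoder for blocklength $n$ is a conditional PMF $\mathbb P[M_1=m_1,M_2=m_2\mid X^n=x^n,Y^n=y^n]$ on $\mathcal M_1\times\mathcal M_2$ for each $(x^n,y^n)\in\mathcal X^n\times\mathcal Y^n$, and the quantities $\mathscr A_{\mathrm B}^{(\mathrm g)}(P_{X^n,Y^n})$, $\mathscr A_{\mathrm B}^{(\mathrm l)}(P_{X^n,Y^n})$, $\mathscr A_{\mathrm E}(P_{X^n,Y^n})$ are given by the formulas for $\mathscr A_{\mathrm B}^{(\mathrm g)}(P_{X,Y})$, $\mathscr A_{\mathrm B}^{(\mathrm l)}(P_{X,Y})$, $\mathscr A_{\mathrm E}(P_{X,Y})$ with $(X^n,Y^n)$ in place of $(X,Y)$ and alphabets $\mathcal X^n,\mathcal Y^n$ in place of $\mathcal X,\mathcal Y$. Let $\mathscr A_{\mathrm B}$ denote one of $\mathscr A_{\mathrm B}^{(\mathrm g)},\mathscr A_{\mathrm B}^{(\mathrm l)}$. A number $E_{\mathrm E}$ is an achievable ambiguity-exponent for $(R_1,R_2)$ if there is a sequence of stochastic encoders (one for each $n$) such that $\lim_{n\to\infty}\mathscr A_{\mathrm B}(P_{X^n,Y^n})=1$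 and $\liminf_{n\to\infty}\frac1n\log\mathscr A_{\mathrm E}(P_{X^n,Y^n})\ge E_{\mathrm E}$. The privacy-exponent $\overline{E_{\mathrm E}}$ is the supremum of all achievable ambiguity-exponents, with $\overline{E_{\mathrm E}}=-\infty$ if no sequence of encoders satisfies $\lim_{n\to\infty}\mathscr A_{\mathrm B}(P_{X^n,Y^n})=1$ (so that the set of achievable ambiguity-exponents is empty). *)

(* Defs.v *)
From HB Require Import structures.
From mathcomp Require Import all_boot all_order all_algebra.
From mathcomp Require Import all_classical all_reals all_analysis.

Set Implicit Arguments.
Unset Strict Implicit.
Unset Printing Implicit Defensive.

Import Order.TTheory GRing.Theory Num.Theory.
Import numFieldNormedType.Exports.

Local Open Scope classical_set_scope.
Local Open Scope ring_scope.

Definition log2 (R : realType) (t : R) : R := ln t / ln 2.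

(* Arimoto's conditional Renyi entropy of a joint PMF [p], for 0 < alpha < 1.
   As [0 `^ alpha = 0], zero-probability pairs contribute nothing. *)
Definition cond_renyi (R : realType) (A B : finType) (alpha : R)
    (p : A -> B -> R) : R :=
  alpha / (1 - alpha) *
  log2 (\sum_(y : B) (\sum_(x : A) p x y `^ alpha) `^ alpha^-1).

(* [enc x y m1 m2] is P[M1 = m1, M2 = m2 | X = x, Y = y]. *)
Record encoder (R : realType) (A B M1 M2 : finType) := Encoder {
  enc :> A -> B -> M1 -> M2 -> R;
  enc_ge0 : forall x y m1 m2, 0 <= enc x y m1 m2;
  enc_sum1 : forall x y, \sum_(m1 : M1) \sum_(m2 : M2) enc x y m1 m2 = 1 }.

(* The guess ['I_#|A|] is 0-based: G(x|w) of the usual convention, with values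
   in {1, ..., |A|}, is [rank g w x] below. *)
Record guessing (W A : finType) := Guessing {
  guess :> W -> A -> 'I_#|A|;
  guess_bij : forall w, bijective (guess w) }.

Definition rank (W A : finType) (g : guessing W A) (w : W) (x : A) : nat :=
  (guess g w x).+1.

Section OneShot.
Variables (R : realType) (rho : R) (A B M1 M2 : finType).
Variables (p : A -> B -> R) (e : encoder R A B M1 M2).

(* E[f(X, Y, M1, M2)] *)
Definition expect (f : A -> B -> M1 -> M2 -> R) : R :=
  \sum_(x : A) \sum_(y : B) \sum_(m1 : M1) \sum_(m2 : M2)
    p x y * e x y m1 m2 * f x y m1 m2.

Definition bob_guess_cost (g : guessing (B * M1 * M2)%type A) : R :=
  expect (fun x y m1 m2 => (rank g (y, m1, m2) x)%:R `^ rho).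

(* There are finitely many guessing functions, so the infima in [bob_guess]
   and [eve] are minima: see [bob_guess_attained] and [eve_attained]. *)
Definition bob_guess : R := inf (range bob_guess_cost).

(* P[X = x | Y = y, M1 = m1, M2 = m2]; it is 0 when the conditioning event is
   null, and such triples (y, m1, m2) have weight 0 in [bob_list]. *)
Definition posterior (x : A) (y : B) (m1 : M1) (m2 : M2) : R :=
  p x y * e x y m1 m2 / \sum_(x' : A) p x' y * e x' y m1 m2.

Definition list_of (y : B) (m1 : M1) (m2 : M2) : {set A} :=
  [set x | 0 < posterior x y m1 m2]%SET.

Definition bob_list : R :=
  expect (fun x y m1 m2 => #|list_of y m1 m2|%:R `^ rho).

Definition eve_cost
    (g : guessing (B * M1)%type A * guessing (B * M2)%type A) : R :=
  expect (fun x y m1 m2 => Num.min ((rank g.1 (y, m1) x)%:R `^ rho)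
                                   ((rank g.2 (y, m2) x)%:R `^ rho)).

Definition eve : R := inf (range eve_cost).

End OneShot.

Variant ambiguity := GuessAmbiguity | ListAmbiguity.

Definition bob (R : realType) (k : ambiguity) (rho : R) (A B M1 M2 : finType)
    (p : A -> B -> R) (e : encoder R A B M1 M2) : R :=
  match k with
  | GuessAmbiguity => bob_guess rho p e
  | ListAmbiguity => bob_list rho p e
  end.

(* [nmsg r n] is the number of positive integers not exceeding 2^(n r). *)
Definition nmsg (R : realType) (r : R) (n : nat) : nat :=
  Num.truncn ((2 : R) `^ (n%:R * r)).

(* A finite-alphabet random variable: measurable for the discrete
   sigma-algebra on [A]. *)
Definition fin_measurable (d : measure_display) (T : measurableType d)
    (A : finType) (X : T -> A) : Prop :=
  forall a : A, measurable (X @^-1` [set a]).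

Section Asymptotic.
Variables (R : realType) (d : measure_display) (T : measurableType d).
Variables (P : probability T R) (A B : finType).
(* X_1, X_2, ... are [X 0], [X 1], ... *)
Variables (X : nat -> T -> A) (Y : nat -> T -> B).

(* the PMF of (X^n, Y^n) *)
Definition pmf_n (n : nat) (x : n.-tuple A) (y : n.-tuple B) : R :=
  fine (P [set w | [tuple X i w | i < n] = x /\ [tuple Y i w | i < n] = y]).

(* H_alpha(X^n|Y^n) / n; the term n = 0 is 0 and plays no role. *)
Definition renyi_per_symbol (alpha : R) (n : nat) : R :=
  cond_renyi alpha (@pmf_n n) / n%:R.

Definition renyi_rate (alpha : R) : R := limn (renyi_per_symbol alpha).

Definition achievable (k : ambiguity) (rho R1 R2 E : R) : Prop :=
  exists e : forall n : nat,
      encoder R (n.-tuple A) (n.-tuple B) 'I_(nmsg R1 n) 'I_(nmsg R2 n),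
    bob k rho (@pmf_n n) (e n) @[n --> \oo] --> (1 : R) /\
    (E%:E <= limn_einf
               (fun n => (n%:R^-1 * log2 (eve rho (@pmf_n n) (e n)))%:E))%E.

(* [ereal_sup set0 = -oo], which is the convention wanted when no sequence of
   encoders drives Bob's ambiguity to 1. *)
Definition privacy_exponent (k : ambiguity) (rho R1 R2 : R) : \bar R :=
  ereal_sup [set E%:E | E in achievable k rho R1 R2].

End Asymptotic.

Section Attained.
Variable R : realType.

Lemma inf_finite_attained (S : set R) : finite_set S -> S !=set0 -> S (inf S).
Proof.
move=> /finite_seqP[s ->] [a /= sa].
have [m sm mP] : exists2 m, m \in s & forall b, b \in s -> m <= b.
  elim: s a sa => [//|c [|c' s] IH] a _.
    by exists c; rewrite ?mem_head// => b; rewrite inE => /eqP->.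
  have [m ms mP] := IH c' (mem_head _ _).
  exists (Num.min c m).
    by rewrite minEle; case: ifP => _; rewrite in_cons ?eqxx ?ms ?orbT.
  by move=> b; rewrite in_cons ge_min => /predU1P[->|/mP ->]; rewrite ?lexx ?orbT.
suff -> : inf [set` s] = m by [].
apply/eqP; rewrite eq_le; apply/andP; split.
  by apply: ge_inf => //; exists m => b /=; exact: mP.
by apply: lb_le_inf; [exists m | move=> b /=; exact: mP].
Qed.

Lemma guessing_nonempty (W A : finType) : inhabited (guessing W A).
Proof. by split; exists (fun _ => enum_rank) => _; exact: enum_rank_bij. Qed.

Variables (rho : R) (A B M1 M2 : finType).
Variables (p : A -> B -> R) (e : encoder R A B M1 M2).

Let code (W : finType) (g : guessing W A) : {ffun W -> {ffun A -> 'I_#|A|}} :=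
  [ffun w => finfun (guess g w)].

Lemma bob_guess_attained : exists g, bob_guess_cost rho p e g = bob_guess rho p e.
Proof.
have [g0] := guessing_nonempty (B * M1 * M2)%type A.
suff /inf_finite_attained : finite_set (range (bob_guess_cost rho p e)).
  by case; [exists (bob_guess_cost rho p e g0), g0 | move=> g _ ?; exists g].
pose F (c : {ffun B * M1 * M2 -> {ffun A -> 'I_#|A|}}) :=
  expect p e (fun x y m1 m2 => (c (y, m1, m2) x).+1%:R `^ rho).
apply: (sub_finite_set (B := range F)); last exact/finite_image/finite_finset.
move=> _ [g _ <-]; exists (code g) => //.
apply: eq_bigr => x _; apply: eq_bigr => y _; apply: eq_bigr => m1 _.
by apply: eq_bigr => m2 _; rewrite !ffunE.
Qed.

Lemma eve_attained : exists g, eve_cost rho p e g = eve rho p e.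
Proof.
have [g1] := guessing_nonempty (B * M1)%type A.
have [g2] := guessing_nonempty (B * M2)%type A.
suff /inf_finite_attained : finite_set (range (eve_cost rho p e)).
  by case; [exists (eve_cost rho p e (g1, g2)), (g1, g2) |
            move=> g _ ?; exists g].
pose F (c : {ffun B * M1 -> {ffun A -> 'I_#|A|}} *
            {ffun B * M2 -> {ffun A -> 'I_#|A|}}) :=
  expect p e (fun x y m1 m2 => Num.min ((c.1 (y, m1) x).+1%:R `^ rho)
                                       ((c.2 (y, m2) x).+1%:R `^ rho)).
apply: (sub_finite_set (B := range F)); last exact/finite_image/finite_finset.
move=> _ [g _ <-]; exists (code g.1, code g.2) => //.
apply: eq_bigr => x _; apply: eq_bigr => y _; apply: eq_bigr => m1 _.
by apply: eq_bigr => m2 _; rewrite !ffunE.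
Qed.

End Attained.

(* Main.v *)
(** With [a = 1/(1+rho)], put [S = \sum_y (\sum_x p x y ^ a)^(1+rho)], which is
    [2^(rho H_a(X|Y))].  Hölder's inequality applied to an observer's guesses,
    whose reciprocals sum to at most a harmonic number per value of the side
    information, bounds the guessing moment below by [S] divided by the
    [rho]-th power of the number of such values, up to a factor polynomial
    in [n].  Guessing in order of decreasing probability costs at most [S].

    Converse: the lower bound for Bob forces [R1 + R2 >= H].  Eve costs at most
    [S] without using her hint, and at most [|M2|^rho] (resp. [|M1|^rho]) times
    Bob's cost by merging his guessing orders over the message she misses.

    Achievability: Bob needs about [2^(nH)] labels for [X^n].  The label is split
    as [(v, v1, v2)]; with a uniform key [u], the messages are [(v + u, v1)] and
    [(u, v2)].  Both together reveal the label, whereas each alone reveals only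
    [v1] or [v2], so that Hölder gives Eve at least
    [S / (|V1| + |V2|)^rho] up to a polynomial factor. *)
Require Import Defs.
From HB Require Import structures.
From mathcomp Require Import all_boot all_order all_algebra.
From mathcomp Require Import all_classical all_reals all_analysis.
From mathcomp Require Import ring lra.

Set Implicit Arguments.
Unset Strict Implicit.
Unset Printing Implicit Defensive.

Import Order.TTheory GRing.Theory Num.Theory.
Import numFieldNormedType.Exports.

Local Open Scope classical_set_scope.
Local Open Scope ring_scope.

(** * Convexity of real powers and the reciprocal form of Hölder's inequality *)

Section RealPowers.
Variable R : realType.
Implicit Types (r s t u : R).

Lemma powR_le r s t : 0 <= r -> 0 <= s -> s <= t -> s `^ r <= t `^ r.
Proof.
by move=> r0 s0 st; apply: ge0_ler_powR; rewrite ?nnegrE// (le_trans s0).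
Qed.

Lemma powR_ge1 r s : 0 <= r -> 1 <= s -> 1 <= s `^ r.
Proof. by move=> r0 s1; rewrite -(congr1 (@^~ r) (powR1 R))/=; apply: powR_le. Qed.

(** Bernoulli's inequality, as Young's inequality for [u] and 1 with conjugate exponents [r] and
    [r / (r - 1)]. *)
Lemma powR_tangent r u : 1 <= r -> 0 <= u -> 1 + r * (u - 1) <= u `^ r.
Proof.
rewrite le_eqVlt => /predU1P[<- u0|r1 u0]; first by rewrite powRr1//; lra.
have r0 : 0 < r by lra.
have c0 : 0 < r / (r - 1) by rewrite divr_gt0 ?subr_gt0.
have conj : r^-1 + (r / (r - 1))^-1 = 1.
  by field; rewrite !gt_eqF// subr_gt0.
have := conjugate_powR u0 ler01 r0 c0 conj.
have -> : (r / (r - 1))^-1 = 1 - r^-1 by lra.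
rewrite mulr1 powR1 mul1r -(ler_pM2l r0) mulrDr mulrCA divff ?gt_eqF// mulr1.
rewrite mulrBr mulr1 divff ?gt_eqF//; lra.
Qed.

(** Sums the tangent-line bound at the mean [m]; its linear part cancels because the weights sum to
    1. *)
Lemma powR_jensen (I : finType) r (w z : I -> R) : 1 <= r ->
  (forall i, 0 <= w i) -> \sum_i w i = 1 -> (forall i, 0 <= z i) ->
  (\sum_i w i * z i) `^ r <= \sum_i w i * z i `^ r.
Proof.
move=> r1 w0 w1 z0; set m := \sum_i w i * z i.
have m0 : 0 <= m by apply: sumr_ge0 => i _; rewrite mulr_ge0.
have [m_eq0|m_neq0] := eqVneq m 0.
  rewrite m_eq0 powR0 ?gt_eqF//; last lra.
  by apply: sumr_ge0 => i _; rewrite mulr_ge0 ?powR_ge0.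
have mr_gt0 : 0 < m `^ r by rewrite powR_gt0 ?lt0r ?m_neq0.
apply: (@le_trans _ _ (\sum_i w i * (m `^ r * (1 + r * (z i / m - 1))))).
  rewrite le_eqVlt; apply/orP; left; apply/eqP.
  transitivity (m `^ r * ((1 - r) * \sum_i w i + r / m * m)).
    by rewrite w1; field.
  rewrite {4}/m !mulr_sumr -big_split/= mulr_sumr; apply: eq_bigr => i _.
  by field.
apply: ler_sum => i _; apply: ler_wpM2l => //.
rewrite -{2}[z i](divfK m_neq0) powRM ?divr_ge0// mulrC ler_wpM2r ?powR_ge0//.
by apply: powR_tangent; rewrite ?divr_ge0.
Qed.

(* Jensen for t^(1+rho) with weights proportional to 1/g. *)
Lemma hoelder_reciprocal (I : finType) rho (q g : I -> R) : 0 < rho ->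
  (forall i, 0 <= q i) -> (forall i, 0 < g i) ->
  (\sum_i q i `^ (1 + rho)^-1) `^ (1 + rho) <=
  (\sum_i q i * g i `^ rho) * (\sum_i (g i)^-1) `^ rho.
Proof.
move=> rho0 q0 g0; have r0 : 0 < 1 + rho by lra.
have rE : 1 + rho != 0 by rewrite gt_eqF.
set W := \sum_i (g i)^-1.
have W0 : 0 <= W by apply: sumr_ge0 => i _; rewrite invr_ge0 ltW.
have [/eqP W_eq0|W_neq0] := boolP (W == 0).
  have noI (i : I) : False.
    have /(_ i isT)/eqP : forall i, true -> (g i)^-1 = 0.
      by apply/psumr_eq0P => // j _; rewrite invr_ge0 ltW.
    by rewrite invr_eq0 gt_eqF.
  rewrite !big1 => [|i|i]; [|by case: (noI i)..].
  by rewrite powR0// mul0r.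
have WP : 0 < W by rewrite lt0r W_neq0.
pose w i := (g i)^-1 / W.
pose z i := q i `^ (1 + rho)^-1 * g i.
have w0 i : 0 <= w i by rewrite divr_ge0 ?invr_ge0 ?ltW.
have w1 : \sum_i w i = 1 by rewrite /w -mulr_suml divff.
have z0 i : 0 <= z i by rewrite mulr_ge0 ?powR_ge0 ?ltW.
have r1 : 1 <= 1 + rho by lra.
have := powR_jensen r1 w0 w1 z0.
have -> : \sum_i w i * z i = (\sum_i q i `^ (1 + rho)^-1) / W.
  rewrite mulr_suml; apply: eq_bigr => i _; rewrite /w /z.
  by field; rewrite W_neq0 gt_eqF.
have -> : \sum_i w i * z i `^ (1 + rho) = (\sum_i q i * g i `^ rho) / W.
  rewrite mulr_suml; apply: eq_bigr => i _; rewrite /w /z.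
  rewrite powRM ?powR_ge0 1?ltW// -powRrM mulVf// powRr1// powRD; last first.
    by rewrite (gt_eqF (g0 i)) implybT.
  rewrite powRr1 1?ltW//.
  by field; rewrite W_neq0 gt_eqF.
rewrite powRM ?invr_ge0//; last by apply: sumr_ge0 => i _; rewrite powR_ge0.
rewrite -powR_inv1// -powRrM mulN1r powRN ler_pdivrMr ?powR_gt0//.
by rewrite -mulrA -powRD ?W_neq0 ?implybT// addKr.
Qed.

End RealPowers.

(** * Harmonic sums of ranks, and ways to build guessing functions *)

Lemma harmonic_dyadic (R : realType) (k N : nat) : (N <= 2 ^ k)%N ->
  \sum_(i < N) (i.+1%:R : R)^-1 <= k.+1%:R.
Proof.
move=> Nk; apply: (@le_trans _ _ (\sum_(i < 2 ^ k) (i.+1%:R : R)^-1)).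
  rewrite (big_ord_widen _ (fun i : nat => (i.+1%:R : R)^-1) Nk).
  rewrite [leRHS](bigID (fun i : 'I__ => i < N)%N)/= lerDl.
  by apply: sumr_ge0 => i _; rewrite invr_ge0 ler0n.
elim: k {N Nk} => [|k IH]; first by rewrite big_ord_recl big_ord0 addr0 invr1.
rewrite -(big_mkord xpredT (fun i => (i.+1%:R : R)^-1)).
have k2 : (2 ^ k <= 2 ^ k.+1)%N by rewrite leq_exp2l.
rewrite (big_cat_nat _ k2)//= big_mkord -natr1 lerD//.
(* The upper half of the range has [2^k] terms, each at most [2^-k], and so adds at most 1. *)
apply: (@le_trans _ _ (\sum_(2 ^ k <= i < 2 ^ k.+1) ((2 ^ k)%:R : R)^-1)).
  rewrite big_nat_cond [leRHS]big_nat_cond; apply: ler_sum => i.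
  rewrite andbT => /andP[ki _]; rewrite lef_pV2 ?posrE ?ltr0n ?expn_gt0//.
  by rewrite ler_nat ltnW.
rewrite sumr_const_nat expnS mul2n -addnn addnK -[X in X <= _]mulr_natl divff//.
Qed.

Lemma sum_rankV (R : realType) (W A : finType) (g : guessing W A) w k :
  (#|A| <= 2 ^ k)%N -> \sum_(x : A) ((rank g w x)%:R : R)^-1 <= k.+1%:R.
Proof.
move=> /(harmonic_dyadic R); apply: le_trans.
by rewrite (reindex (guess g w)); [|exact/onW_bij/guess_bij].
Qed.

Lemma card_rank_le (W A : finType) (g : guessing W A) w (k : nat) :
  (#|[set x | rank g w x <= k]%SET| <= k)%N.
Proof.
have ginj : injective (fun x => val (guess g w x)).
  by have [h gK _] := guess_bij g w; move=> x x' /val_inj/(can_inj gK).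
rewrite cardE -(size_map (fun x => val (guess g w x))) -[leqRHS](size_iota 0 k).
apply: uniq_leq_size; first by rewrite map_inj_uniq ?enum_uniq.
by move=> _ /mapP[x + ->]; rewrite mem_enum inE mem_iota.
Qed.

(** Guessing in increasing order of [key]: whatever precedes [x] has a key at most that of [x]. Ties
    are broken arbitrarily, so the bound counts them all. *)
Lemma guessing_by_key (W A : finType) d (K : orderType d) (key : W -> A -> K) :
  exists g : guessing W A,
    forall w x, (rank g w x <= #|[set x' | key w x' <= key w x]%O%SET|)%N.
Proof.
pose le w := [rel x x' : A | (key w x <= key w x')%O].
pose s w := sort (le w) (enum A).
have s_size w : size (s w) = #|A| by rewrite size_sort -cardE.
have s_mem w x : x \in s w by rewrite mem_sort mem_enum.
have s_idx w x : (index x (s w) < #|A|)%N by rewrite -(s_size w) index_mem.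
have s_bij w : bijective (fun x => Ordinal (s_idx w x)).
  apply: inj_card_bij; last by rewrite card_ord.
  by move=> x x' [] /index_inj ->.
exists (Guessing s_bij) => w x; rewrite /rank/=.
have le_total : total (le w) by move=> ? ?; exact: le_total.
have le_tr : transitive (le w) by move=> ? ? ?; exact: le_trans.
set t := take (index x (s w)).+1 (s w).
have <- : size t = (index x (s w)).+1 by rewrite size_takel ?s_size.
have /card_uniqP <- : uniq t by rewrite take_uniq// sort_uniq enum_uniq.
apply/subset_leq_card/fintype.subsetP => x' x't; rewrite inE.
have le_refl : reflexive (le w) by move=> ?; exact: lexx.
have s_sorted : sorted (le w) (s w) by exact: sort_sorted.
apply: (sorted_leq_index le_tr le_refl s_sorted) => //.
by rewrite -ltnS -in_take.
Qed.

(** The merged order sorts by the smallest rank that any [m] gives; for each [m] at most [k]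
    elements have rank at most [k], so at most [#|M| * k] have key at most [k]. *)
Lemma guessing_merge (W M A V : finType) (g : guessing V A) (j : W -> M -> V) :
  exists g' : guessing W A,
    forall w m x, (rank g' w x <= #|M| * rank g (j w m) x)%N.
Proof.
case: (pickP (fun _ : M => true)) => [m0 _|noM]; last first.
  by have [g'] := guessing_nonempty W A; exists g' => w m; have := noM m.
pose best w x := [arg min_(m < m0) rank g (j w m) x].
pose key w x : nat := rank g (j w (best w x)) x.
have key_le w m x : (key w x <= rank g (j w m) x)%N.
  by rewrite /key /best; case: arg_minnP => // m' _ ->.
have [g' g'P] := guessing_by_key key; exists g' => w m x.
apply: (leq_trans (g'P w x)); apply: (@leq_trans (#|M| * key w x)); last first.
  by rewrite leq_mul2l key_le orbT.
apply: (@leq_trans (\sum_(m' : M) #|[set x' | rank g (j w m') x' <= key w x]%SET|)).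
  apply: (@leq_trans
    #|(\bigcup_m' [set x' | (rank g (j w m') x' <= key w x)%N])%SET|); last first.
    elim/big_rec2: _ => [|m' n S _ Sn]; first by rewrite cards0.
    by rewrite (leq_trans (leq_card_setU _ _))// leq_add2l.
  apply/subset_leq_card/fintype.subsetP => x'; rewrite inE leEnat => kx'.
  by apply/bigcupP; exists (best w x'); rewrite ?inE.
by rewrite -sum_nat_const; apply: leq_sum => m' _; exact: card_rank_le.
Qed.

(** * One-shot bounds on the observers' costs for an arbitrary encoder *)

Section OneShotBounds.
Variables (R : realType) (rho : R) (A B : finType) (p : A -> B -> R).
Hypothesis rho_gt0 : 0 < rho.
Hypothesis p_ge0 : forall x y, 0 <= p x y.

Let rho_ge0 : 0 <= rho. Proof. exact: ltW. Qed.

(* Equal to 2^(rho H_{1/(1+rho)}(X|Y)). *)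
Definition renyi_moment : R :=
  \sum_(y : B) (\sum_(x : A) p x y `^ (1 + rho)^-1) `^ (1 + rho).

(** Guessing by decreasing probability. With [a = 1/(1+rho)], each [x'] guessed no later than [x]
    contributes at least 1 to the sum of [(p x' y / p x y)^a], so this sum bounds the rank. *)
Lemma likely_guess : exists g : guessing B A,
  \sum_(x : A) \sum_(y : B) p x y * (rank g y x)%:R `^ rho <= renyi_moment.
Proof.
have r0 : 0 < 1 + rho by rewrite addr_gt0.
have [g gP] := guessing_by_key (fun y x => - p x y).
exists g; rewrite exchange_big; apply: ler_sum => y _.
set T := \sum_x _ `^ _^-1.
have T0 : 0 <= T by apply: sumr_ge0 => x _; exact: powR_ge0.
rewrite powRD; last by rewrite gt_eqF.
rewrite powRr1// {1}/T mulr_suml; apply: ler_sum => x _.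
have [->|pxy] := eqVneq (p x y) 0; first by rewrite mul0r powR0 ?mul0r// gt_eqF ?invr_gt0.
have pxy0 : 0 < p x y by rewrite lt0r pxy p_ge0.
have rank_le : (rank g y x)%:R <= T / p x y `^ (1 + rho)^-1.
  apply: (@le_trans _ _ (#|[set x' | p x y <= p x' y]%SET|%:R)).
    rewrite ler_nat; apply: leq_trans (gP y x) _.
    by apply/subset_leq_card/fintype.subsetP => x'; rewrite !inE lerN2.
  rewrite -sum1_card natr_sum /T mulr_suml big_mkcond/=; apply: ler_sum => x' _.
  case: ifPn => [|_]; last by rewrite mulr_ge0 ?invr_ge0 ?powR_ge0.
  rewrite inE => pxx'; rewrite ler_pdivlMr ?powR_gt0// mul1r powR_le//.
  by rewrite invr_ge0 ltW.
apply: le_trans (_ : p x y * (T / p x y `^ (1 + rho)^-1) `^ rho <= _).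
  by rewrite ler_pM2l// powR_le.
rewrite powRM ?invr_ge0 ?powR_ge0// -powRN -!powRrM mulrCA mulrC ler_wpM2r ?powR_ge0//.
rewrite -{1}(powRr1 (p_ge0 x y)) -powRD ?pxy ?implybT// le_eqVlt.
by apply/orP; left; apply/eqP; congr (_ `^ _); field; rewrite gt_eqF.
Qed.

Section Encoded.
Variables (M1 M2 : finType) (e : encoder R A B M1 M2).

Lemma expect_le (f f' : A -> B -> M1 -> M2 -> R) :
  (forall x y m1 m2, 0 < p x y * e x y m1 m2 -> f x y m1 m2 <= f' x y m1 m2) ->
  expect p e f <= expect p e f'.
Proof.
move=> ff'; apply: ler_sum => x _; apply: ler_sum => y _.
apply: ler_sum => m1 _; apply: ler_sum => m2 _.
have := mulr_ge0 (p_ge0 x y) (enc_ge0 e x y m1 m2).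
rewrite le_eqVlt => /predU1P[<-|pe0]; first by rewrite !mul0r.
by apply: ler_wpM2l; [exact: ltW|exact: ff'].
Qed.

Lemma expect_const_message (f : A -> B -> R) :
  expect p e (fun x y _ _ => f x y) = \sum_(x : A) \sum_(y : B) p x y * f x y.
Proof.
apply: eq_bigr => x _; apply: eq_bigr => y _.
under eq_bigr do rewrite -mulr_suml.
rewrite -mulr_suml; congr (_ * _).
under eq_bigr do rewrite -mulr_sumr.
by rewrite -mulr_sumr enc_sum1 mulr1.
Qed.

Lemma expectZ (c : R) (f : A -> B -> M1 -> M2 -> R) :
  expect p e (fun x y m1 m2 => c * f x y m1 m2) = c * expect p e f.
Proof.
rewrite /expect; do 4!(rewrite mulr_sumr; apply: eq_bigr => ? _).
by rewrite mulrCA.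
Qed.

Lemma inf_range_le (T : Type) (c : T -> R) t : (forall t, 0 <= c t) -> inf (range c) <= c t.
Proof.
move=> c0; apply: ge_inf; last by exists t.
by exists 0 => _ [t' _ <-]; exact: c0.
Qed.

Lemma expect_ge0 (f : A -> B -> M1 -> M2 -> R) :
  (forall x y m1 m2, 0 <= f x y m1 m2) -> 0 <= expect p e f.
Proof.
move=> f0; do 4!apply: sumr_ge0 => ? _.
by apply: mulr_ge0 => //; apply: mulr_ge0 => //; exact: enc_ge0.
Qed.

Lemma bob_guess_le g : bob_guess rho p e <= bob_guess_cost rho p e g.
Proof.
by apply: inf_range_le => {}g; apply: expect_ge0 => *; exact: powR_ge0.
Qed.

Lemma eve_le g : eve rho p e <= eve_cost rho p e g.
Proof.
apply: inf_range_le => {}g; apply: expect_ge0 => *.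
by rewrite le_min !powR_ge0.
Qed.

Lemma eve_le_renyi_moment : eve rho p e <= renyi_moment.
Proof.
have [g gP] := likely_guess; apply: le_trans gP.
have bij1 (w : B * M1) : bijective (guess g w.1) by exact: guess_bij.
have bij2 (w : B * M2) : bijective (guess g w.1) by exact: guess_bij.
apply: (le_trans (eve_le (Guessing bij1, Guessing bij2))).
rewrite -expect_const_message; apply: expect_le => x y m1 m2 _.
by rewrite ge_min lexx.
Qed.

Lemma eve_le_bob_guess2 : eve rho p e <= #|M2|%:R `^ rho * bob_guess rho p e.
Proof.
have [g <-] := bob_guess_attained rho p e.
have [g1 g1P] := guessing_merge g (fun (w : B * M1) (m2 : M2) => (w, m2)).
have [g2] := guessing_nonempty (B * M2)%type A.
apply: (le_trans (eve_le (g1, g2))).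
rewrite -expectZ; apply: expect_le => x y m1 m2 _.
rewrite ge_min -powRM// -natrM powR_le// ?ler_nat//=.
Qed.

Lemma eve_le_bob_guess1 : eve rho p e <= #|M1|%:R `^ rho * bob_guess rho p e.
Proof.
have [g <-] := bob_guess_attained rho p e.
have [g2 g2P] := guessing_merge g (fun (w : B * M2) (m1 : M1) => (w.1, m1, w.2)).
have [g1] := guessing_nonempty (B * M1)%type A.
apply: (le_trans (eve_le (g1, g2))).
rewrite -expectZ; apply: expect_le => x y m1 m2 _.
rewrite ge_min orbC -powRM// -natrM powR_le// ?ler_nat//=.
Qed.

Lemma mem_list_of x y m1 m2 :
  0 < p x y * e x y m1 m2 -> x \in list_of p e y m1 m2.
Proof.
move=> pe0; rewrite inE divr_gt0// (bigD1 x)//= ltr_pwDl// sumr_ge0// => x' _.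
by rewrite mulr_ge0 ?enc_ge0.
Qed.

(** Bob guesses the members of his list first, as [false] precedes [true]; the true [x] is among
    them. *)
Lemma bob_guess_le_list : bob_guess rho p e <= bob_list rho p e.
Proof.
have [g gP] := guessing_by_key
  (fun (w : B * M1 * M2) x => x \notin list_of p e w.1.1 w.1.2 w.2).
apply: le_trans (bob_guess_le g) _; apply: expect_le => x y m1 m2 pe0.
rewrite powR_le// ler_nat; apply: leq_trans (gP _ _) _.
apply/subset_leq_card/fintype.subsetP => x'.
by rewrite inE/= (mem_list_of pe0)/= leEbool; case: (x' \in _).
Qed.

Lemma bob_guess_le_bob k : bob_guess rho p e <= bob k rho p e.
Proof. by case: k => //=; exact: bob_guess_le_list. Qed.

Lemma bob_le_list k : bob k rho p e <= bob_list rho p e.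
Proof. by case: k => //=; exact: bob_guess_le_list. Qed.

Lemma rank_powR_ge1 (W : finType) (g : guessing W A) w x :
  1 <= (rank g w x)%:R `^ rho :> R.
Proof. by rewrite powR_ge1// ler1n. Qed.

Lemma bob_guess_ge1 : \sum_(x : A) \sum_(y : B) p x y = 1 ->
  1 <= bob_guess rho p e.
Proof.
move=> p1; have [g <-] := bob_guess_attained rho p e.
apply: (@le_trans _ _ (expect p e (fun _ _ _ _ => 1))).
  rewrite expect_const_message -[leLHS]p1.
  by do 2!apply: ler_sum => ? _; rewrite mulr1.
by apply: expect_le => *; exact: rank_powR_ge1.
Qed.

Lemma eve_ge1 : \sum_(x : A) \sum_(y : B) p x y = 1 -> 1 <= eve rho p e.
Proof.
move=> p1; have [g <-] := eve_attained rho p e.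
apply: (@le_trans _ _ (expect p e (fun _ _ _ _ => 1))).
  rewrite expect_const_message -[leLHS]p1.
  by do 2!apply: ler_sum => ? _; rewrite mulr1.
by apply: expect_le => *; rewrite le_min !rank_powR_ge1.
Qed.

End Encoded.
End OneShotBounds.

Lemma enc_le1 (R : realType) (A B M1 M2 : finType) (e : encoder R A B M1 M2)
  x y m1 m2 : e x y m1 m2 <= 1.
Proof.
rewrite -(enc_sum1 e x y) (bigD1 m1)//= (bigD1 m2)//= -addrA lerDl.
by rewrite addr_ge0// sumr_ge0// => *; rewrite ?sumr_ge0// => *; exact: enc_ge0.
Qed.

(** For fixed [x], distinct [u] give distinct observations [h x u], so the sum over [u] is part of
    the sum over all [w]; for fixed [w] the ranks give a harmonic sum. *)
Lemma sum_rankV_inj (R : realType) (U W W' A : finType) (g : guessing W' A)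
    (j : W -> W') (h : A -> U -> W) k :
  (forall x, injective (h x)) -> (#|A| <= 2 ^ k)%N ->
  \sum_x \sum_u ((rank g (j (h x u)) x)%:R : R)^-1 <= (#|W| * k.+1)%:R.
Proof.
move=> h_inj Ak.
apply: (@le_trans _ _ (\sum_x \sum_w ((rank g (j w) x)%:R : R)^-1)).
  apply: ler_sum => x _.
  have -> : \sum_u ((rank g (j (h x u)) x)%:R : R)^-1 =
      \sum_(w in (h x @: [set: U])%SET) ((rank g (j w) x)%:R)^-1.
    rewrite big_imset/=; last by move=> ? ? _ _; exact: h_inj.
    by apply: eq_bigl => u; rewrite inE.
  rewrite [leRHS](bigID (mem (h x @: [set: U])%SET))/= lerDl.
  by apply: sumr_ge0 => w _; rewrite invr_ge0.
rewrite exchange_big/= natrM mulr_natl -sumr_const.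
by apply: ler_sum => w _; exact: sum_rankV.
Qed.

(** * Converse: a lower bound on Bob's guessing cost *)

Section Converse.
Variables (R : realType) (rho : R) (A B M1 M2 : finType) (p : A -> B -> R).
Variable e : encoder R A B M1 M2.
Hypothesis rho_gt0 : 0 < rho.
Hypothesis p_ge0 : forall x y, 0 <= p x y.

Let rho_ge0 : 0 <= rho. Proof. exact: ltW. Qed.

Lemma renyi_moment_le_bob_guess k : (#|A| <= 2 ^ k)%N ->
  renyi_moment rho p <=
  bob_guess rho p e * (#|M1| * #|M2| * k.+1)%:R `^ rho.
Proof.
move=> Ak; have r1 : 1 <= 1 + rho by rewrite lerDl.
have r0 : 0 < 1 + rho by rewrite addr_gt0.
have [g <-] := bob_guess_attained rho p e.
rewrite /bob_guess_cost /expect exchange_big/= mulr_suml; apply: ler_sum => y _.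
pose q (i : A * (M1 * M2)) := p i.1 y * e i.1 y i.2.1 i.2.2.
pose r (i : A * (M1 * M2)) : R := (rank g (y, i.2.1, i.2.2) i.1)%:R.
have q0 i : 0 <= q i by rewrite mulr_ge0 ?enc_ge0.
have rP i : 0 < r i by rewrite ltr0n.
(* Splitting [p x y] over the messages can only increase the sum of powers: the exponent and each
   [e x y m1 m2] are at most 1, so the power of the latter is at least [e x y m1 m2]. *)
apply: (@le_trans _ _ ((\sum_i q i `^ (1 + rho)^-1) `^ (1 + rho))).
  apply: powR_le; [exact: ltW|by apply: sumr_ge0 => *; exact: powR_ge0|].
  rewrite -(pair_bigA _ (fun x m => q (x, m) `^ (1 + rho)^-1))/=.
  apply: ler_sum => x _.
  rewrite -[leLHS]mulr1 -[X in _ * X <= _](enc_sum1 e x y) pair_bigA/= mulr_sumr.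
  apply: ler_sum => -[m1 m2] _ /=; rewrite powRM ?enc_ge0//.
  apply: ler_wpM2l; first exact: powR_ge0.
  have := enc_ge0 e x y m1 m2; rewrite le_eqVlt => /predU1P[<-|e0].
    exact: powR_ge0.
  by apply: ger1_powR; rewrite ?e0 ?enc_le1// invf_le1.
apply: (le_trans (hoelder_reciprocal rho_gt0 q0 rP)).
have -> : \sum_i q i * r i `^ rho = \sum_x \sum_m1 \sum_m2
    p x y * e x y m1 m2 * (rank g (y, m1, m2) x)%:R `^ rho.
  rewrite -(pair_bigA _ (fun x m => q (x, m) * r (x, m) `^ rho))/=.
  by apply: eq_bigr => x _; rewrite pair_bigA.
rewrite ler_wpM2l//.
  by do 3!apply: sumr_ge0 => ? _; rewrite mulr_ge0 ?powR_ge0// mulr_ge0 ?enc_ge0.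
rewrite powR_le//; first by apply: sumr_ge0 => i _; rewrite invr_ge0 ltW.
rewrite -(pair_bigA _ (fun x m => (r (x, m))^-1))/= exchange_big/=.
rewrite -card_prod natrM mulr_natl -sumr_const.
by apply: ler_sum => -[m1 m2] _; exact: (sum_rankV R g (y, m1, m2) Ak).
Qed.

End Converse.

(** * The secret-sharing encoder *)

Section SecretSharing.
Variables (R : realType) (A B M1 M2 T V1 V2 : finType).
(** Injectivity in the first argument lets Bob undo the key; injectivity in the second makes the
    first message determine the key once the label is known. [T0] makes [T] nonempty, so that
    [uniform] is a probability. *)
Variables (T0 : T) (add : T -> T -> T).
Hypothesis add_inj : forall t, injective (add t).
Hypothesis addI : forall u, injective (add^~ u).
Variables (i1 : T * V1 -> M1) (i2 : T * V2 -> M2) (f : A -> B -> T * V1 * V2).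
Hypotheses (i1_inj : injective i1) (i2_inj : injective i2).

Let msg1 x y u := i1 (add (f x y).1.1 u, (f x y).1.2).
Let msg2 x y u := i2 (u, (f x y).2).
Let uniform : R := #|T|%:R^-1.

Let T_gt0 : (0 < #|T|)%N. Proof. by apply/card_gt0P; exists T0. Qed.

Let uniform_ge0 : 0 <= uniform. Proof. by rewrite invr_ge0. Qed.

Definition share x y m1 m2 : R :=
  \sum_(u : T) uniform *+ ((m1 == msg1 x y u) && (m2 == msg2 x y u)).

Lemma share_ge0 x y m1 m2 : 0 <= share x y m1 m2.
Proof. by apply: sumr_ge0 => u _; rewrite mulrn_wge0. Qed.

Lemma sum_share x y (F : M1 -> M2 -> R) :
  \sum_(m1 : M1) \sum_(m2 : M2) share x y m1 m2 * F m1 m2 =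
  \sum_(u : T) uniform * F (msg1 x y u) (msg2 x y u).
Proof.
rewrite pair_bigA/=; under eq_bigr do rewrite mulr_suml.
rewrite exchange_big/=; apply: eq_bigr => u _.
rewrite (bigD1 (msg1 x y u, msg2 x y u))//= !eqxx mulr1n big1 ?addr0// => -[m1 m2].
by rewrite xpair_eqE => /negbTE/= ->; rewrite mulr0n mul0r.
Qed.

Lemma share_sum1 x y : \sum_(m1 : M1) \sum_(m2 : M2) share x y m1 m2 = 1.
Proof.
have := sum_share x y (fun _ _ => 1); rewrite sumr_const mulr1 /uniform.
rewrite -[RHS]mulr_natl divff ?pnatr_eq0 -?lt0n// => <-.
by do 2!apply: eq_bigr => ? _; rewrite mulr1.
Qed.

Definition share_encoder := Encoder share_ge0 share_sum1.

Lemma share_neq0 x y m1 m2 : share x y m1 m2 != 0 ->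
  exists u, m1 = msg1 x y u /\ m2 = msg2 x y u.
Proof.
move=> s_neq0; have [/existsP[u /andP[/eqP-> /eqP->]]|/existsPn no] :=
  boolP [exists u, (m1 == msg1 x y u) && (m2 == msg2 x y u)]; first by exists u.
by case/eqP: s_neq0; apply: big1 => u _; rewrite (negbTE (no u)).
Qed.

(** The second message reveals the key and [v2]; the first reveals [v1] and the masked [v], which
    the key unmasks. *)
Lemma share_decode x x' y m1 m2 :
  share x y m1 m2 != 0 -> share x' y m1 m2 != 0 -> f x y = f x' y.
Proof.
move=> /share_neq0[u [-> ->]] /share_neq0[u' [/i1_inj[e1 e2] /i2_inj[e3 e4]]].
move: e1; rewrite -e3 => /addI e1.
rewrite [LHS]surjective_pairing [(f x y).1]surjective_pairing e1 e2 e4.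
by rewrite -!surjective_pairing.
Qed.

Variables (rho : R) (p : A -> B -> R).
Hypothesis rho_gt0 : 0 < rho.
Hypothesis p_ge0 : forall x y, 0 <= p x y.

Let rho_ge0 : 0 <= rho. Proof. exact: ltW. Qed.

Lemma bob_list_share : bob_list rho p share_encoder <=
  \sum_(x : A) \sum_(y : B)
    p x y * #|[set x' | f x' y == f x y]%SET|%:R `^ rho.
Proof.
rewrite -(expect_const_message p share_encoder).
apply: expect_le => //= x y m1 m2 pe0; rewrite powR_le// ler_nat.
apply/subset_leq_card/fintype.subsetP => x'; rewrite !inE /posterior/= => post.
apply/eqP/(@share_decode _ _ y m1 m2).
  by apply: contraTneq post => ->; rewrite mulr0 mul0r ltxx.
by apply: contraTneq pe0 => ->; rewrite mulr0 ltxx.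
Qed.

(** Hölder over the pairs [(x, u)] for each [y], with the smaller of the two ranks as guess
    count. *)
Lemma renyi_moment_le_eve_share k : (#|A| <= 2 ^ k)%N ->
  renyi_moment rho p <=
  eve rho p share_encoder * ((#|V1| + #|V2|) * k.+1)%:R `^ rho.
Proof.
move=> Ak; have r1 : 1 <= 1 + rho by rewrite lerDl.
have r0 : 0 < 1 + rho by rewrite addr_gt0.
have TP : 0 < #|T|%:R :> R by rewrite ltr0n.
have [[g1 g2] <-] := eve_attained rho p share_encoder.
rewrite /eve_cost /expect exchange_big/= mulr_suml; apply: ler_sum => y _.
pose q (i : A * T) := p i.1 y * uniform.
pose r (i : A * T) : R := Num.min (rank g1 (y, msg1 i.1 y i.2) i.1)%:R
                                  (rank g2 (y, msg2 i.1 y i.2) i.1)%:R.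
have q0 i : 0 <= q i by rewrite mulr_ge0.
have rP i : 0 < r i by rewrite lt_min !ltr0n.
have := hoelder_reciprocal rho_gt0 q0 rP.
(* The sum over keys gives [#|T| * #|T|^(-1/(1+rho))]; raised to the power [1 + rho] this is
   [#|T|^rho], the factor that the harmonic sums produce on the right. *)
have -> : \sum_i q i `^ (1 + rho)^-1 =
    (\sum_x p x y `^ (1 + rho)^-1) * #|T|%:R `^ (rho / (1 + rho)).
  rewrite -(pair_bigA _ (fun x u => q (x, u) `^ (1 + rho)^-1))/= mulr_suml.
  apply: eq_bigr => x _; rewrite /q/= sumr_const -[LHS]mulr_natl powRM// mulrCA.
  congr (_ * _); rewrite /uniform -powR_inv1// -powRrM mulN1r.
  rewrite -{1}(powRr1 (ltW TP)) -powRD ?(gt_eqF TP) ?implybT//.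
  by congr (_ `^ _); field; rewrite gt_eqF.
have -> : \sum_i q i * r i `^ rho = \sum_x \sum_m1 \sum_m2
    p x y * share x y m1 m2 * Num.min ((rank g1 (y, m1) x)%:R `^ rho)
                                      ((rank g2 (y, m2) x)%:R `^ rho).
  rewrite -(pair_bigA _ (fun x u => q (x, u) * r (x, u) `^ rho))/=.
  apply: eq_bigr => x _.
  under [RHS]eq_bigr do under eq_bigr do rewrite -mulrA.
  under [RHS]eq_bigr do rewrite -mulr_sumr.
  rewrite -mulr_sumr sum_share mulr_sumr; apply: eq_bigr => u _.
  rewrite /q /r/= -mulrA; congr (_ * (_ * _)).
  rewrite !minEle; have [le12|lt21] := leP ((rank g1 _ _)%:R : R).
    by rewrite powR_le.
  case: ifPn => // le12; apply/eqP; rewrite eq_le le12 powR_le//; exact: ltW.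
set E := \sum_x \sum_(m1 : M1) _; have E0 : 0 <= E.
  do 3!apply: sumr_ge0 => ? _; rewrite mulr_ge0 ?le_min ?powR_ge0//.
  by rewrite mulr_ge0 ?share_ge0.
rewrite powRM ?sumr_ge0 ?powR_ge0// => [|*]; last exact: powR_ge0.
rewrite -powRrM divfK ?gt_eqF//.
rewrite -(ler_pM2r (powR_gt0 rho TP)) => /le_trans -> //.
rewrite -mulrA -powRM// -natrM; apply: ler_wpM2l => //; apply: powR_le => //.
  by apply: sumr_ge0 => i _; rewrite invr_ge0 ltW.
rewrite -(pair_bigA _ (fun x u => (r (x, u))^-1))/=.
rewrite (_ : ((_ + _) * _ * _)%N =
  #|T| * #|V1| * k.+1 + #|T| * #|V2| * k.+1)%N; last by ring.
have h1_inj x : injective (fun u => (add (f x y).1.1 u, (f x y).1.2)).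
  by move=> u u' [/add_inj].
have h2_inj x : injective (fun u : T => (u, (f x y).2)) by move=> u u' [].
have := lerD (sum_rankV_inj R g1 (fun v => (y, i1 v)) h1_inj Ak)
             (sum_rankV_inj R g2 (fun v => (y, i2 v)) h2_inj Ak).
rewrite -natrD !card_prod; apply: le_trans.
(* The reciprocal of a minimum is at most the sum of the reciprocals, so the two observers are
   bounded separately. *)
rewrite -big_split; apply: ler_sum => x _; rewrite -big_split; apply: ler_sum => u _.
rewrite /r/= minEle; case: ifP => _.
  by rewrite lerDl invr_ge0.
by rewrite lerDr invr_ge0.
Qed.

End SecretSharing.

(** * Binning and one-shot achievability *)

Lemma injection_of_card (S T : finType) : (#|S| <= #|T|)%N ->
  exists i : S -> T, injective i.
Proof.
move=> ST; exists (fun x => enum_val (widen_ord ST (enum_rank x))).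
by move=> x x' /enum_val_inj [] /val_inj/enum_rank_inj.
Qed.

(* Bin the rank [r] by its residue mod [c] and the dyadic level
   [2^t <= r %/ c < 2^t.+1]: a bin has at most one element per quotient in its
   level, so at most [2^t <= r %/ c] of them. *)
Lemma dyadic_binning (A B V : finType) (g : guessing B A) (c k : nat) :
  (#|A| <= 2 ^ k)%N -> (0 < c)%N -> (c * k.+1 <= #|V|)%N ->
  exists f : A -> B -> V, forall x y,
    (#|[set x' | f x' y == f x y]%SET| <= maxn 1 (guess g y x %/ c))%N.
Proof.
move=> Ak c0 ckV.
have /injection_of_card[i i_inj] : (#|{: 'I_k.+1 * 'I_c}| <= #|V|)%N.
  by rewrite card_prod !card_ord mulnC.
pose quo x y := (guess g y x %/ c)%N.
(* Level 0 is reserved for quotient 0; quotients in [[2^t, 2^(t+1))] get level [t + 1]. *)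
pose lev q := if q is 0 then 0%N else (trunc_log 2 q).+1.
have lev_lt x y : (lev (quo x y) < k.+1)%N.
  rewrite /lev; case E: (quo x y) => [//|q].
  rewrite ltnS -(ltn_exp2l _ _ (ltnSn 1)) -E.
  apply: leq_ltn_trans (trunc_logP _ _) _; rewrite ?E// -E.
  by apply: leq_ltn_trans (leq_div _ _) _; apply: leq_trans Ak.
have mod_lt x y : (guess g y x %% c < c)%N by rewrite ltn_mod.
exists (fun x y => i (Ordinal (lev_lt x y), Ordinal (mod_lt x y))) => x y.
set S := [set x' | _]%SET.
have SP x' : x' \in S -> lev (quo x' y) = lev (quo x y) /\
    guess g y x' = guess g y x %[mod c].
  by rewrite inE => /eqP/i_inj[].
have quo_inj : {in S &, injective (quo^~ y)}.
  move=> x1 x2 /SP[_ m1] /SP[_ m2] q12.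
  have [h gK _] := guess_bij g y; apply/(can_inj gK)/val_inj => /=.
  by rewrite (divn_eq (guess g y x1) c) (divn_eq (guess g y x2) c) m1 m2 -/(quo x1 y) q12.
rewrite cardE -(size_map (quo^~ y)).
pose q2 := (2 ^ trunc_log 2 (quo x y))%N.
pose b := if quo x y == 0%N then (0, 1)%N else (q2, q2).
apply: (@leq_trans (size (iota b.1 b.2))); last first.
  rewrite size_iota /b; case: ifPn => [_|q0]; first exact: leq_maxl.
  by rewrite leq_max trunc_logP ?lt0n ?orbT.
apply: uniq_leq_size.
  by rewrite map_inj_in_uniq ?enum_uniq// => ? ?; rewrite !mem_enum; exact: quo_inj.
move=> _ /mapP[x' + ->]; rewrite mem_enum => /SP[+ _]; rewrite mem_iota /b /q2.
case: (quo x y) => [|q]; case: (quo x' y) => [|q']//= [levE].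
by rewrite -levE addnn -mul2n -expnS trunc_logP// trunc_log_ltn.
Qed.

Section Achievability.
Variables (R : realType) (rho : R) (A B M1 M2 : finType) (p : A -> B -> R).
Hypothesis rho_gt0 : 0 < rho.
Hypothesis p_ge0 : forall x y, 0 <= p x y.
Hypothesis p_sum1 : \sum_(x : A) \sum_(y : B) p x y = 1.

Let rho_ge0 : 0 <= rho. Proof. exact: ltW. Qed.

(** [s.+1] is the order of the cyclic key group, [c1] and [c2] count the public parts, and [c] is
    the number of residues in the binning. If [q] is the quotient of the 0-based guess by [c], Bob's
    list has at most [max(1, q)] elements, and [max(1, q)^rho <= 1 + (rank / c)^rho]. *)
Lemma exists_encoder (s c1 c2 c k : nat) :
  (#|A| <= 2 ^ k)%N -> (s.+1 * c1 <= #|M1|)%N -> (s.+1 * c2 <= #|M2|)%N ->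
  (0 < c)%N -> (c * k.+1 <= s.+1 * c1 * c2)%N ->
  exists e : encoder R A B M1 M2,
    bob_list rho p e <= 1 + renyi_moment rho p / c%:R `^ rho /\
    renyi_moment rho p <= eve rho p e * ((c1 + c2) * k.+1)%:R `^ rho.
Proof.
move=> Ak sM1 sM2 c0 ckV.
have cP : 0 < c%:R :> R by rewrite ltr0n.
have [g gP] := likely_guess rho_gt0 p_ge0.
have /(dyadic_binning g Ak c0)[f fP] :
    (c * k.+1 <= #|{: 'I_s.+1 * 'I_c1 * 'I_c2}|)%N.
  by rewrite !card_prod !card_ord.
have /injection_of_card[i1 i1_inj] : (#|{: 'I_s.+1 * 'I_c1}| <= #|M1|)%N.
  by rewrite card_prod !card_ord.
have /injection_of_card[i2 i2_inj] : (#|{: 'I_s.+1 * 'I_c2}| <= #|M2|)%N.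
  by rewrite card_prod !card_ord.
pose e := share_encoder R (ord0 : 'I_s.+1) +%R i1 i2 f.
exists e; split; last first.
  rewrite -{1}(card_ord c1) -{1}(card_ord c2).
  exact: (renyi_moment_le_eve_share _ (@addrI _)).
have addr_inj (u : 'I_s.+1) : injective (+%R^~ u) by exact: addIr.
apply: (le_trans (bob_list_share ord0 addr_inj f i1_inj i2_inj rho_gt0 p_ge0)).
rewrite -[X in _ <= X + _]p_sum1; apply: (@le_trans _ _ (\sum_x \sum_y p x y +
    (\sum_x \sum_y p x y * (rank g y x)%:R `^ rho) / c%:R `^ rho)); last first.
  by rewrite lerD2l ler_wpM2r ?invr_ge0 ?powR_ge0.
rewrite mulr_suml -big_split; apply: ler_sum => x _.
rewrite mulr_suml -big_split; apply: ler_sum => y _.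
rewrite -mulrA -[X in _ <= X + _]mulr1 -mulrDr; apply: ler_wpM2l => //.
apply: (@le_trans _ _ ((maxn 1 (guess g y x %/ c))%:R `^ rho)).
  by apply: powR_le; rewrite ?ler_nat.
rewrite -powR_inv1 ?powR_ge0// -powRrM mulrN1 powRN.
rewrite -[X in _ <= _ + X](_ : ((rank g y x)%:R / c%:R) `^ rho = _); last first.
  by rewrite powRM ?invr_ge0// -powR_inv1 ?ltW// -powRrM mulN1r powRN.
have [q0|q1] := leqP (guess g y x %/ c) 1.
  by rewrite powR1 lerDl powR_ge0.
rewrite -[leLHS]add0r lerD// powR_le// ler_pdivlMr// -natrM ler_nat.
by rewrite (leq_trans (leq_divM _ _)).
Qed.

End Achievability.

(** * The joint law of the first [n] symbols *)

Section ProcessPMF.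
Context (R : realType) (d : measure_display) (T : measurableType d).
Context (P : probability T R) (A B : finType).
Context (X : nat -> T -> A) (Y : nat -> T -> B).
Hypothesis mX : forall i, fin_measurable (X i).
Hypothesis mY : forall i, fin_measurable (Y i).

Let event n (z : n.-tuple A * n.-tuple B) : set T :=
  [set w | [tuple X i w | i < n] = z.1 /\ [tuple Y i w | i < n] = z.2].

Lemma measurable_tuple_eq (C : finType) (Z : nat -> T -> C) n (z : n.-tuple C) :
  (forall i, fin_measurable (Z i)) -> measurable [set w | [tuple Z i w | i < n] = z].
Proof.
move=> mZ.
rewrite (_ : mkset _ = \bigcap_(i in [set: 'I_n]) (Z i @^-1` [set tnth z i])).
  by apply: fin_bigcap_measurable; [exact: finite_finset|move=> i _; exact: mZ].
apply/seteqP; split => w /=; first by move=> <- i _ /=; rewrite tnth_mktuple.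
by move=> wz; apply: eq_from_tnth => i; rewrite tnth_mktuple; exact: wz.
Qed.

Let measurable_event n z : measurable (@event n z).
Proof. by apply: measurableI; exact: measurable_tuple_eq. Qed.

Lemma pmf_n_ge0 n x y : 0 <= pmf_n P X Y (n := n) x y.
Proof. by apply: fine_ge0; exact: measure_ge0. Qed.

Lemma pmf_n_sum1 n : \sum_x \sum_y pmf_n P X Y (n := n) x y = 1.
Proof.
apply: EFin_inj; rewrite pair_bigA/= -sumEFin -(@probability_setT _ _ _ P).
have -> : [set: T] = \bigcup_(z in [set: n.-tuple A * n.-tuple B]) event z.
  apply/seteqP; split => w // _.
  by exists ([tuple X i w | i < n], [tuple Y i w | i < n]).
rewrite measure_fin_bigcup//; [|exact: finite_finset|].
  have <- : [set` index_enum (n.-tuple A * n.-tuple B)%type] = setT.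
    by apply/seteqP; split => z //= _; exact: mem_index_enum.
  rewrite -fsbig_seq ?index_enum_uniq//.
  apply: eq_bigr => z _; rewrite /pmf_n fineK// fin_num_measure//.
  exact: measurable_event.
by move=> [x y] [x' y'] _ _ [w [[/= <- <-] [/= -> ->]]].
Qed.

End ProcessPMF.

(** * Exponential growth rates and lower limits *)

Section ExponentialRates.
Variable R : realType.
Implicit Types (c s t u x : R) (n : nat).

Local Notation pow2 x := ((2 : R) `^ x).

Lemma pow2_gt0 x : 0 < pow2 x. Proof. by rewrite powR_gt0. Qed.

Lemma pow2D s t : pow2 (s + t) = pow2 s * pow2 t.
Proof. by rewrite powRD// pnatr_eq0 implybT. Qed.

Lemma pow2_le s t : s <= t -> pow2 s <= pow2 t.
Proof. by apply: ler_powR; rewrite ler1n. Qed.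

Lemma ln2_gt0 : 0 < ln (2 : R). Proof. by rewrite ln_gt0// ltr1n. Qed.

Lemma log2K u : 0 < u -> pow2 (log2 u) = u.
Proof.
by move=> u0; rewrite /powR pnatr_eq0/= divfK ?gt_eqF ?ln2_gt0// lnK.
Qed.

Lemma pow2K x : log2 (pow2 x) = x.
Proof. by rewrite /log2 ln_powR mulfK// gt_eqF// ln2_gt0. Qed.

Lemma log2_le s t : 0 < s -> s <= t -> log2 s <= log2 t.
Proof.
move=> s0 st; rewrite ler_pM2r ?invr_gt0 ?ln2_gt0// ler_ln// posrE.
exact: lt_le_trans st.
Qed.

Lemma log2_rate_le n c u : (0 < n)%N -> 0 < u -> u <= pow2 (n%:R * c) ->
  n%:R^-1 * log2 u <= c.
Proof.
move=> n0 u0 uc; rewrite mulrC ler_pdivrMr ?ltr0n// mulrC -[leRHS]pow2K.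
exact: log2_le.
Qed.

Lemma log2_rate_ge n c u : (0 < n)%N -> pow2 (n%:R * c) <= u ->
  c <= n%:R^-1 * log2 u.
Proof.
move=> n0 uc; rewrite [leRHS]mulrC ler_pdivlMr ?ltr0n// mulrC -[leLHS]pow2K.
exact: log2_le (pow2_gt0 _) uc.
Qed.

(** With [b = t * ln 2] the exponential is at least [(n b)^2 / 2], which outgrows any affine
    function of [n]. *)
Lemma pow2_dominates c s t : 0 < t ->
  \forall n \near \oo, c * n%:R + s <= pow2 (n%:R * t).
Proof.
move=> t0; pose b := t * ln 2.
have b0 : 0 < b by rewrite mulr_gt0 ?ln2_gt0.
near=> n; have n1 : 1 <= n%:R :> R by near: n; exact: nbhs_infty_ger.
have nb : (`|c| + `|s|) * 2 / b ^+ 2 <= n%:R by near: n; exact: nbhs_infty_ger.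
rewrite /powR pnatr_eq0/= -mulrA -/b.
have nb0 : 0 <= n%:R * b by rewrite mulr_ge0// ltW.
apply: le_trans (expR_ge1Dxn 1 nb0).
apply: (@le_trans _ _ ((`|c| + `|s|) * n%:R)).
  rewrite mulrDl lerD ?ler_wpM2r ?ler_norm//.
  by rewrite (le_trans (ler_norm s))// ler_peMr.
rewrite ler_pdivrMr ?exprn_gt0// in nb.
apply: (@le_trans _ _ ((n%:R * b) ^+ 2 / 2)); last by rewrite lerDr.
rewrite ler_pdivlMr// mulrAC (_ : (_ * b) ^+ 2 = n%:R * b ^+ 2 * n%:R); last by ring.
by rewrite ler_wpM2r.
Unshelve. all: by end_near. Qed.

Lemma truncn_pow2_le x : (Num.truncn (pow2 x))%:R <= pow2 x.
Proof. by rewrite truncn_le ltW ?pow2_gt0. Qed.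

Lemma truncn_pow2_gt0 x : 0 <= x -> (0 < Num.truncn (pow2 x))%N.
Proof. by move=> x0; rewrite truncn_gt0 powR_ge1// ler1n. Qed.

(** For [y >= 1], [y < floor y + 1 <= 2 floor y]: rounding down loses at most a factor 2. *)
Lemma truncn_pow2_ge x : 0 <= x -> pow2 (x - 1) <= (Num.truncn (pow2 x))%:R.
Proof.
move=> x0; have := truncnS_gt (pow2 x); have := truncn_pow2_gt0 x0.
rewrite -(ler_nat R) -[leLHS]/1; set m := _%:R => m1.
rewrite -natr1 -/m pow2D powRN powRr1// ler_pdivrMr// => lt_m; lra.
Qed.

Lemma limn_einf_le (u : nat -> \bar R) (c : \bar R) :
  (\forall n \near \oo, (u n <= c)%E) -> (limn_einf u <= c)%E.
Proof.
move=> uc; rewrite limn_einf_lim; apply: lime_le; first exact: is_cvg_einfs.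
near=> n; apply: (@le_trans _ _ (u n)); last by near: n.
by apply: ereal_inf_lbound; exists n => /=.
Unshelve. all: by end_near. Qed.

Lemma limn_einf_ge (u : nat -> \bar R) (c : \bar R) :
  (\forall n \near \oo, (c <= u n)%E) -> (c <= limn_einf u)%E.
Proof.
move=> [N _ cu]; rewrite limn_einf_lim; apply: lime_ge; first exact: is_cvg_einfs.
near=> n; apply: le_ereal_inf_tmp => _ [m /= nm <-]; apply: cu => /=.
by apply: leq_trans nm; near: n; exists N.
Unshelve. all: by end_near. Qed.

Lemma exponent_le (u : nat -> R) (E c : R) :
  (E%:E <= limn_einf (fun n => (n%:R^-1 * log2 (u n))%:E))%E ->
  (forall n, 0 < u n) ->
  (forall t, 0 < t -> \forall n \near \oo, u n <= pow2 (n%:R * (c + t))) -> E <= c.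
Proof.
move=> Eu u0 uc; apply/ler_addgt0Pr => t t0; rewrite -lee_fin.
apply: le_trans Eu _; apply: limn_einf_le; near=> n; rewrite lee_fin.
apply: log2_rate_le => //; [by near: n; exists 1%N|by near: n; exact: uc].
Unshelve. all: by end_near. Qed.

End ExponentialRates.

(** Constant messages, as secret sharing with a one-element key. *)
Lemma encoder_nonempty (R : realType) (A B M1 M2 : finType) :
  (0 < #|M1|)%N -> (0 < #|M2|)%N -> inhabited (encoder R A B M1 M2).
Proof.
move=> /card_gt0P[m1 _] /card_gt0P[m2 _]; split.
exact: (share_encoder R tt (fun _ _ => tt) (fun _ : unit * unit => m1)
          (fun _ : unit * unit => m2) (fun _ _ => (tt, tt, tt))).
Qed.

(** * The moment as an exponential of the entropy, and message counts *)

Section RenyiMoment.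
Variables (R : realType) (A B : finType) (p : A -> B -> R) (rho : R).
Hypothesis rho_gt0 : 0 < rho.
Hypothesis p_ge0 : forall x y, 0 <= p x y.
Hypothesis p_sum1 : \sum_(x : A) \sum_(y : B) p x y = 1.

(** Eve's ambiguity under any encoder lies between 1 and the moment. *)
Lemma renyi_moment_ge1 : 1 <= renyi_moment rho p.
Proof.
have [e] : inhabited (encoder R A B unit unit).
  by apply: encoder_nonempty; rewrite card_unit.
exact: le_trans (eve_ge1 rho_gt0 p_ge0 e p_sum1) (eve_le_renyi_moment rho_gt0 p_ge0 e).
Qed.

Lemma renyi_momentE :
  renyi_moment rho p = 2 `^ (rho * cond_renyi (1 + rho)^-1 p).
Proof.
have r0 : 0 < 1 + rho by rewrite addr_gt0.
rewrite /cond_renyi invrK -/(renyi_moment rho p) mulrA.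
(* For [alpha = 1/(1+rho)] the prefactor [alpha / (1 - alpha)] is [1/rho]. *)
rewrite (_ : rho * _ = 1).
  by rewrite mul1r log2K// (lt_le_trans ltr01 renyi_moment_ge1).
by field; rewrite addrAC subrr add0r !gt_eqF.
Qed.

Lemma cond_renyi_ge0 : 0 <= cond_renyi (1 + rho)^-1 p.
Proof.
have r0 : 0 < 1 + rho by rewrite addr_gt0.
rewrite /cond_renyi invrK -/(renyi_moment rho p) mulr_ge0//.
  by rewrite divr_ge0 ?subr_ge0 ?invf_le1 ?invr_ge0 ?lerDl ?ltW.
by apply: divr_ge0; [exact/ln_ge0/renyi_moment_ge1|exact/ltW/ln2_gt0].
Qed.

End RenyiMoment.

Section MessageCounts.
Variables (R : realType) (r : R) (n : nat).

Lemma nmsg_le : (nmsg r n)%:R <= (2 : R) `^ (n%:R * r).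
Proof. exact: truncn_pow2_le. Qed.

Lemma nmsg_gt0 : 0 <= r -> (0 < nmsg r n)%N.
Proof. by move=> r0; rewrite truncn_pow2_gt0// mulr_ge0. Qed.

(** Lets [k = n * #|A|] serve in the one-shot bounds, whose factor [k.+1] is then affine in [n]. *)
Lemma card_tuple_le (A : finType) : (#|{: n.-tuple A}| <= 2 ^ (n * #|A|))%N.
Proof.
rewrite card_tuple mulnC expnM; case: n => // m.
by rewrite leq_exp2r// ltnW// ltn_expl.
Qed.

End MessageCounts.

(** * Exponents of the process *)

Section Exponents.
Context (R : realType) (d : measure_display) (T : measurableType d).
Context (P : probability T R) (A B : finType).
Context (X : nat -> T -> A) (Y : nat -> T -> B) (rho : R).
Hypothesis mX : forall i, fin_measurable (X i).
Hypothesis mY : forall i, fin_measurable (Y i).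
Hypothesis rho_gt0 : 0 < rho.
Hypothesis rate_ex : cvgn (renyi_per_symbol P X Y (1 + rho)^-1).

Let p n := pmf_n P X Y (n := n).
Let h := renyi_per_symbol P X Y (1 + rho)^-1.
Let H := renyi_rate P X Y (1 + rho)^-1.

Let p_ge0 n x y : 0 <= p (n := n) x y. Proof. exact: pmf_n_ge0. Qed.

Let p_sum1 n : \sum_x \sum_y p (n := n) x y = 1.
Proof. exact: pmf_n_sum1. Qed.

Let rho_ge0 : 0 <= rho. Proof. exact: ltW. Qed.

Let h_cvg : h n @[n --> \oo] --> H. Proof. exact: rate_ex. Qed.

Lemma renyi_rate_ge0 : 0 <= H.
Proof.
apply: limr_ge => //; near=> n; rewrite divr_ge0//.
exact: (cond_renyi_ge0 rho_gt0 (@p_ge0 n) (p_sum1 n)).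
Unshelve. all: by end_near. Qed.

Lemma renyi_moment_n n : (0 < n)%N ->
  renyi_moment rho (@p n) = 2 `^ (n%:R * (rho * h n)).
Proof.
move=> n0; rewrite (renyi_momentE rho_gt0 (@p_ge0 n) (p_sum1 n)); congr (_ `^ _).
by rewrite /h /renyi_per_symbol [RHS]mulrC -mulrA divfK// pnatr_eq0 -lt0n.
Qed.

(** * Asymptotic converse *)

Section Encoders.
Variables (R1 R2 : R) (k : ambiguity).
Variable e : forall n : nat,
  encoder R (n.-tuple A) (n.-tuple B) 'I_(nmsg R1 n) 'I_(nmsg R2 n).
Hypothesis bob_cvg1 : bob k rho (@p n) (e n) @[n --> \oo] --> (1 : R).

(** All that the converse draws from Bob's limit; since the guessing ambiguity is the smaller one,
    it covers both cases. *)
Let bob_guess_le2 : \forall n \near \oo, bob_guess rho (@p n) (e n) <= 2.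
Proof.
near=> n; apply: le_trans (bob_guess_le_bob rho_gt0 (@p_ge0 n) (e n) k) _.
by apply: ltW; near: n; apply: cvgr_lt bob_cvg1 _ _; rewrite ltr1n.
Unshelve. all: by end_near. Qed.

Lemma bob_cvg1_sum_rate : H <= R1 + R2.
Proof.
rewrite leNgt; apply/negP => R12H.
(* Half the gap, so [R1 + R2 = H - 2 t]. The moment grows at rate at least [rho (H - t)], while the
   bound through Bob has rate [rho (H - 2 t + t / 4)]. *)
pose t := (H - (R1 + R2)) / 2.
have t0 : 0 < t by rewrite divr_gt0// subr_gt0.
pose K := #|A|.
suff /filter_ex[] : \forall n \near \oo, False by [].
near=> n.
have n0 : (0 < n)%N by near: n; exists 1%N.
have bob2 : bob_guess rho (@p n) (e n) <= 2 by near: n; exact: bob_guess_le2.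
have hn : H - t < h n.
  by near: n; apply: cvgr_gt h_cvg _ _; rewrite ltrBlDr ltrDl.
have Kn : K%:R * n%:R + 1 <= 2 `^ (n%:R * (t / 4)).
  by near: n; apply: pow2_dominates; rewrite divr_gt0.
(* Makes [3/4 * n * rho * t] exceed 1, which absorbs the bound 2 on Bob's cost. *)
have nt : (rho * t)^-1 * 2 <= n%:R by near: n; exact: nbhs_infty_ger.
have := renyi_moment_le_bob_guess (e n) rho_gt0 (@p_ge0 n) (card_tuple_le n A).
rewrite renyi_moment_n// !card_ord.
apply/negP; rewrite -ltNge.
apply: (@le_lt_trans _ _ (2 * (2 `^ (n%:R * (R1 + R2)) * 2 `^ (n%:R * (t / 4))) `^ rho)).
  apply: ler_pM => //; first exact: le_trans ler01
    (bob_guess_ge1 rho_gt0 (@p_ge0 n) (e n) (p_sum1 n)).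
  apply: powR_le => //; rewrite natrM; apply: ler_pM => //; last first.
    by rewrite -natr1 natrM mulrC.
  by rewrite natrM mulrDr pow2D ler_pM// nmsg_le.
rewrite -pow2D -powRrM -{1}[2]powRr1// -pow2D.
rewrite /powR pnatr_eq0/= ltr_expR ltr_pM2r ?ln2_gt0//.
rewrite [n%:R * _ + _](_ : _ = n%:R * (H - t - (3 / 4) * t)); last first.
  by rewrite /t; field.
have splitE (N Q s : R) : 1 + N * (Q - 3 / 4 * s) * rho =
    rho * (N * Q) + (1 - 3 / 4 * (N * rho * s)) by field.
rewrite [ltRHS]mulrCA splitE.
rewrite -[ltRHS]addr0 -ltrBrDl.
have : rho * (n%:R * (H - t)) < rho * (n%:R * h n) by rewrite ltr_pM2l// ltr_pM2l// ltr0n.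
have : 2 <= n%:R * rho * t.
  by rewrite [n%:R * rho]mulrC mulrAC -ler_pdivrMl; [exact: nt|rewrite mulr_gt0].
lra.
Unshelve. all: by end_near. Qed.

Let eve_gt0 n : 0 < eve rho (@p n) (e n).
Proof. exact: lt_le_trans ltr01 (eve_ge1 rho_gt0 (@p_ge0 n) (e n) (p_sum1 n)). Qed.

Variable E : R.
Hypothesis E_le :
  (E%:E <= limn_einf (fun n => (n%:R^-1 * log2 (eve rho (@p n) (e n)))%:E))%E.

Lemma exponent_le_renyi_rate : E <= rho * H.
Proof.
apply: (exponent_le E_le eve_gt0) => t t0; near=> n.
have n0 : (0 < n)%N by near: n; exists 1%N.
apply: le_trans (eve_le_renyi_moment rho_gt0 (@p_ge0 n) (e n)) _.
rewrite renyi_moment_n// pow2_le// ler_wpM2l//.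
have : h n < H + t / rho.
  by near: n; apply: cvgr_lt h_cvg _ _; rewrite ltrDl divr_gt0.
move=> /ltW hn; rewrite -[t](mulfVK (lt0r_neq0 rho_gt0)) [t / rho * _]mulrC.
by rewrite -mulrDr ler_wpM2l.
Unshelve. all: by end_near. Qed.

(** Here [r] is to be the rate of the message that one observer misses; Bob's cost, at most 2, is
    absorbed in the slack once [n >= 1/t]. *)
Lemma exponent_le_rate (r : R) :
  (forall n, eve rho (@p n) (e n) <=
             (nmsg r n)%:R `^ rho * bob_guess rho (@p n) (e n)) -> E <= rho * r.
Proof.
move=> eve_r; apply: (exponent_le E_le eve_gt0) => t t0; near=> n.
apply: le_trans (eve_r n) _; rewrite mulrDr pow2D; apply: ler_pM.
- exact: powR_ge0.
- exact: le_trans ler01 (bob_guess_ge1 rho_gt0 (@p_ge0 n) (e n) (p_sum1 n)).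
- by rewrite mulrCA mulrC powRrM powR_le// nmsg_le.
- apply: le_trans (_ : 2 <= _); first by near: n; exact: bob_guess_le2.
  rewrite -[leLHS]powRr1// pow2_le// -ler_pdivrMr// div1r.
  by near: n; exact: nbhs_infty_ger.
Unshelve. all: by end_near. Qed.

End Encoders.

(** * Asymptotic achievability *)

Section Achievable.
Variables (R1 R2 delta : R).
Hypothesis R1_gt0 : 0 < R1.
Hypothesis R2_gt0 : 0 < R2.
Hypothesis delta_gt0 : 0 < delta.
Hypothesis sum_rate : H + delta <= R1 + R2.

(** Of the three [delta], one is the excess of the label rate over [H], one bounds the shortfall of
    [h n] below [H], one covers the polynomial factors. *)
Let exponent : R := rho * (Num.min R1 (Num.min R2 H) - 3 * delta).

(** The explicit bound [harmonic n], which is [1/(n+1)], allows choosing the encoder for each [n]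
    separately. *)
Let good n (e : encoder R (n.-tuple A) (n.-tuple B) 'I_(nmsg R1 n) 'I_(nmsg R2 n)) :=
  bob_list rho (@p n) e <= 1 + harmonic n /\
  2 `^ (n%:R * exponent) <= eve rho (@p n) e.

(* The secret has rate [s], the public parts rates [r1] and [r2], where
   [s + r1 = min R1 K], [s + r2 = min R2 K] and [s + r1 + r2 = K]. *)
Lemma exists_good_encoder : \forall n \near \oo, exists e, @good n e.
Proof.
pose K := H + delta; pose m := Num.min R1 (Num.min R2 H).
pose r1 := K - Num.min R2 K; pose r2 := K - Num.min R1 K.
pose s := K - r1 - r2.
have H0 := renyi_rate_ge0.
have r1_ge0 : 0 <= r1 by rewrite subr_ge0 ge_min lexx orbT.
have r2_ge0 : 0 <= r2 by rewrite subr_ge0 ge_min lexx orbT.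
(* [s = min R1 K + min R2 K - K], with [K <= R1 + R2]. *)
have s_ge0 : 0 <= s.
  rewrite /s /r1 /r2; move: sum_rate (ltW R1_gt0) (ltW R2_gt0) (ltW delta_gt0).
  rewrite -/K => sR R10 R20 d0; have : 0 <= K by rewrite addr_ge0.
  by rewrite !minEle; do 2!case: ifPn => _; lra.
have sr1 : s + r1 <= R1.
  by rewrite /s addrAC subrK /r2 opprB addrC subrK ge_min lexx.
have sr2 : s + r2 <= R2.
  by rewrite /s subrK /r1 opprB addrC subrK ge_min lexx.
have HK : H <= K by rewrite lerDl ltW.
have mK : m <= K by rewrite !ge_min HK !orbT.
have mR1 : m <= Num.min R1 K by rewrite le_min mK andbT ge_min lexx.
have mR2 : m <= Num.min R2 K by rewrite le_min mK andbT !ge_min lexx orbT.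
(* The public parts set Eve's exponent, about [rho (H - max r1 r2)]; bounding both rates by [K - m]
   leaves about [rho m]. *)
have r1_le : r1 <= K - m by rewrite lerD2l lerN2.
have r2_le : r2 <= K - m by rewrite lerD2l lerN2.
near=> n.
have n0 : (0 < n)%N by near: n; exists 1%N.
have hn_gt : H - delta < h n.
  by near: n; apply: cvgr_gt h_cvg _ _; rewrite ltrBlDr ltrDl.
have hn_lt : h n < H + delta / 4.
  by near: n; apply: cvgr_lt h_cvg _ _; rewrite ltrDl divr_gt0.
pose k := (n * #|A|)%N.
(* The 3 pays for rounding [S], [c1] and [c2] down, at most a factor 2 each. *)
have kn : k.+1%:R <= (2 : R) `^ (n%:R * (delta / 2) - 3).
  rewrite pow2D powRN ler_pdivlMr ?pow2_gt0// powR_mulrn// -natr1 natrM.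
  have : (8 * #|A|%:R) * n%:R + 8 <= (2 : R) `^ (n%:R * (delta / 2)).
    by near: n; apply: pow2_dominates; rewrite divr_gt0.
  by apply: le_trans; rewrite le_eqVlt; apply/orP; left; apply/eqP; ring.
(* For Bob: the rate of [c] exceeds [h n] by more than [delta / 4], which pays for the factor
   [n + 1] and for [2^rho] lost in rounding [c]. *)
have harm : 2 `^ rho * n%:R + 2 `^ rho <= 2 `^ (n%:R * (rho * (delta / 4))).
  by near: n; apply: pow2_dominates; rewrite mulr_gt0// divr_gt0.
have ge0 x : 0 <= x -> 0 <= n%:R * x by move=> x0; rewrite mulr_ge0.
pose S := nmsg s n; pose c1 := nmsg r1 n; pose c2 := nmsg r2 n.
pose c := nmsg (H + delta / 2) n.
have S0 : (0 < S)%N by apply: nmsg_gt0.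
have Hd_ge0 : 0 <= H + delta / 2 by rewrite addr_ge0// ltW// divr_gt0.
have c0 : (0 < c)%N by apply: nmsg_gt0.
(* [exists_encoder] takes the key count as a successor, so the positive [S] enters through
   [S.-1]. *)
have [] := exists_encoder (M1 := 'I_(nmsg R1 n)) (M2 := 'I_(nmsg R2 n))
  (s := S.-1) (c1 := c1) (c2 := c2) (c := c) (k := k)
  rho_gt0 (@p_ge0 n) (p_sum1 n) _ _ _ _ _.
- exact: card_tuple_le.
- rewrite prednK// card_ord truncn_ge_nat ?powR_ge0// natrM.
  apply: (@le_trans _ _ (2 `^ (n%:R * s) * 2 `^ (n%:R * r1))).
    by apply: ler_pM => //; exact: nmsg_le.
  by rewrite -pow2D -mulrDr pow2_le// ler_wpM2l.
- rewrite prednK// card_ord truncn_ge_nat ?powR_ge0// natrM.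
  apply: (@le_trans _ _ (2 `^ (n%:R * s) * 2 `^ (n%:R * r2))).
    by apply: ler_pM => //; exact: nmsg_le.
  by rewrite -pow2D -mulrDr pow2_le// ler_wpM2l.
- by [].
- rewrite prednK// -(ler_nat R) !natrM.
  apply: (@le_trans _ _ (2 `^ (n%:R * (H + delta / 2)) * 2 `^ (n%:R * (delta / 2) - 3))).
    by apply: ler_pM => //; exact: nmsg_le.
  rewrite -pow2D [X in 2 `^ X <= _](_ : _ =
    (n%:R * s - 1) + (n%:R * r1 - 1) + (n%:R * r2 - 1)); last first.
    by rewrite /s /K; field.
  by rewrite !pow2D !ler_pM ?mulr_ge0 ?powR_ge0// -pow2D truncn_pow2_ge// ge0.
move=> e [bob_e eve_e]; exists e; split.
  apply: le_trans bob_e _; rewrite lerD2l renyi_moment_n//.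
  rewrite ler_pdivrMr ?powR_gt0 ?ltr0n//.
  apply: (@le_trans _ _ (harmonic n *
    (2 `^ (n%:R * (H + delta / 2) - 1)) `^ rho)); last first.
    rewrite ler_wpM2l ?harmonic_ge0// powR_le ?powR_ge0//.
    by rewrite truncn_pow2_ge// ge0.
  rewrite /harmonic ler_pdivlMl ?ltr0n// -powRrM.
  apply: (@le_trans _ _ (n.+1%:R * 2 `^ (n%:R * (rho * (H + delta / 4))))).
    by rewrite ler_wpM2l// pow2_le// ler_wpM2l// ler_wpM2l// ltW.
  rewrite (_ : (_ - 1) * rho = n%:R * (rho * (delta / 4)) - rho +
    n%:R * (rho * (H + delta / 4))); last by field.
  rewrite [leRHS]pow2D ler_wpM2r ?powR_ge0// pow2D powRN ler_pdivlMr ?pow2_gt0//.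
  by apply: le_trans harm; rewrite -natr1 mulrDl mul1r mulrC.
have c12 : ((c1 + c2) * k.+1)%:R <= (2 : R) `^ (n%:R * (K - m + delta)).
  rewrite natrM natrD; apply: (@le_trans _ _
    ((2 `^ (n%:R * (K - m)) + 2 `^ (n%:R * (K - m))) * 2 `^ (n%:R * (delta / 2) - 3))).
    apply: ler_pM => //; apply: lerD; apply: le_trans (nmsg_le _ _) _.
      by rewrite pow2_le// ler_wpM2l.
    by rewrite pow2_le// ler_wpM2l.
  have double (x : R) : 2 `^ x + 2 `^ x = 2 `^ (x + 1).
    by rewrite pow2D powRr1// mulr_natr mulr2n.
  rewrite double -pow2D pow2_le//.
  rewrite [n%:R * (_ + delta)]mulrDr.
  have : 0 <= n%:R * (delta / 2) by rewrite ge0// ltW// divr_gt0.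
  lra.
move: eve_e; rewrite renyi_moment_n// => eve_e.
have eve0 : 0 <= eve rho (@p n) e.
  exact: le_trans ler01 (eve_ge1 rho_gt0 (@p_ge0 n) e (p_sum1 n)).
(* Up to the factor [rho n], the exponents on the left add up to [(m - 3 delta) + (K - m + delta) =
   H - delta], which is below [h n]. *)
rewrite -(ler_pM2r (pow2_gt0 (n%:R * (rho * (K - m + delta))))) -pow2D -mulrDr.
apply: (@le_trans _ _ (2 `^ (n%:R * (rho * h n)))).
  rewrite pow2_le// ler_wpM2l// /exponent -mulrDr ler_wpM2l//.
  by apply: le_trans (ltW hn_gt); rewrite -/m /K le_eqVlt; apply/orP; left; apply/eqP; ring.
apply: le_trans eve_e _; rewrite ler_wpM2l//.
by rewrite mulrCA mulrC powRrM powR_le.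
Unshelve. all: by end_near. Qed.

Lemma achievable_exponent k : achievable P X Y k rho R1 R2 exponent.
Proof.
(* A good encoder where one exists, any encoder for the finitely many other [n]. *)
have enc n : {e | (exists e', @good n e') -> @good n e}.
  apply: cid; have [[e' ge']|no] := pselect (exists e', @good n e').
    by exists e'.
  have [e] : inhabited (encoder R (n.-tuple A) (n.-tuple B) 'I_(nmsg R1 n) 'I_(nmsg R2 n)).
    by apply: encoder_nonempty; rewrite card_ord nmsg_gt0// ltW.
  by exists e.
have good_enc : \forall n \near \oo, good (sval (enc n)).
  by near=> n; apply: (svalP (enc n)); near: n; exact: exists_good_encoder.
exists (fun n => sval (enc n)); split.
  (* For either [k], Bob's value lies between the guessing ambiguity, at least 1, and the list
     ambiguity. *)
  apply: (squeeze_cvgr (f := cst 1) (h := fun n => 1 + harmonic n)).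
  - near=> n; have [bob_e _] : good (sval (enc n)) by near: n; exact: good_enc.
    apply/andP; split.
      apply: le_trans (bob_guess_le_bob rho_gt0 (@p_ge0 n) _ k).
      exact: bob_guess_ge1.
    exact: le_trans (bob_le_list rho_gt0 (@p_ge0 n) _ k) bob_e.
  - exact: cvg_cst.
  - rewrite -[X in _ --> X]addr0; apply: cvgD; [exact: cvg_cst|exact: cvg_harmonic].
apply: limn_einf_ge; near=> n.
have [_ eve_e] : good (sval (enc n)) by near: n; exact: good_enc.
by rewrite lee_fin log2_rate_ge//; near: n; exists 1%N.
Unshelve. all: by end_near. Qed.

End Achievable.

Lemma privacy_exponentE k R1 R2 : 0 < R1 -> 0 < R2 -> H < R1 + R2 ->
  privacy_exponent P X Y k rho R1 R2 = (rho * Num.min R1 (Num.min R2 H))%:E.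
Proof.
move=> R10 R20 HR; apply/eqP; rewrite eq_le; apply/andP; split.
  apply: ge_ereal_sup => _ [E [e [bob_e eve_e]] <-].
  rewrite lee_fin !minr_pMr// !le_min; apply/and3P; split.
  - apply: (exponent_le_rate bob_e eve_e) => n.
    by have := eve_le_bob_guess1 rho_gt0 (@p_ge0 n) (e n); rewrite card_ord.
  - apply: (exponent_le_rate bob_e eve_e) => n.
    by have := eve_le_bob_guess2 rho_gt0 (@p_ge0 n) (e n); rewrite card_ord.
  - exact: exponent_le_renyi_rate eve_e.
apply/lee_addgt0Pr => t t0.
(* The first bound gives [3 rho delta <= t], the second gives the [sum_rate] condition. *)
pose delta := Num.min (t / rho / 3) (R1 + R2 - H).
have d0 : 0 < delta by rewrite lt_min !divr_gt0//= subr_gt0.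
have sR : H + delta <= R1 + R2 by rewrite addrC -lerBrDr ge_min lexx orbT.
apply: (@le_trans _ _ ((rho * (Num.min R1 (Num.min R2 H) - 3 * delta))%:E + t%:E)%E).
  rewrite -EFinD lee_fin mulrBr -addrA lerDl addrC subr_ge0.
  have : delta <= t / rho / 3 by rewrite ge_min lexx.
  by rewrite ler_pdivlMr// ler_pdivlMr// mulrC [3 * _]mulrC.
apply: leeD => //; apply: ereal_sup_ubound.
exists (rho * (Num.min R1 (Num.min R2 H) - 3 * delta)) => //.
exact: achievable_exponent.
Qed.

Lemma privacy_exponentNy k R1 R2 : R1 + R2 < H ->
  privacy_exponent P X Y k rho R1 R2 = -oo%E.
Proof.
move=> HR; rewrite /privacy_exponent -[RHS]ereal_sup0; congr ereal_sup.
apply/seteqP; split => // z [E [e [bob_e _]] _].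
by have := bob_cvg1_sum_rate bob_e; rewrite leNgt HR.
Qed.

End Exponents.

Theorem corollary4 (R : realType) (d : measure_display) (T : measurableType d)
    (P : probability T R) (A B : finType)
    (X : nat -> T -> A) (Y : nat -> T -> B)
    (mX : forall i, fin_measurable (X i)) (mY : forall i, fin_measurable (Y i))
    (rho : R) (rho_gt0 : 0 < rho)
    (rate_ex : cvgn (renyi_per_symbol P X Y (1 + rho)^-1))
    (R1 R2 : R) (R1_gt0 : 0 < R1) (R2_gt0 : 0 < R2) (k : ambiguity) :
  let H := renyi_rate P X Y (1 + rho)^-1 in
  (R1 + R2 > H ->
     privacy_exponent P X Y k rho R1 R2
       = (rho * Num.min R1 (Num.min R2 H))%:E) /\
  (R1 + R2 < H -> privacy_exponent P X Y k rho R1 R2 = -oo%E).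
Proof.
by split; [exact: privacy_exponentE|exact: privacy_exponentNy].
Qed.
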